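(* Let Assumption 1' hold. For every $c_1,\dots,c_n\in\mathbb{R}$, every $x_0\in\mathbb{R}^{pn}$ and every locally integrable input $u(\cdot)$, consider $\dot x=A_{\mathrm M}x+B_{\mathrm M}u$, $y=C_{\mathrm M}x$, $x(0)=x_0$, together with the filters $\dot\zeta=A_{\mathrm r,m}\zeta+B_{\mathrm r,m}u$, $\zeta(0)=0_{mn,1}$, and $\dot\mu=A_{\mathrm r,p}\mu+B_{\mathrm r,p}y$, $\mu(0)=0_{pn,1}$. Then $\chi=\mathrm{col}(\zeta,\mu)\in\mathbb{R}^{(m+p)n}$ satisfies, for all $t\ge0$, \[\dot\chi(t)=A_{\mathrm M,\mathrm f}\chi(t)+B_{\mathrm M,\mathrm f}u(t)+G_{\mathrm M,\mathrm f}\,\mathrm{e}^{A_{\mathrm r,p}^\top t}x_0,\] and the pair $(A_{\mathrm M,\mathrm f},B_{\mathrm M,\mathrm f})$ is reachable.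
   Context: Fix integers $n,m,p\ge1$ and matrices $A_i\in\mathbb{R}^{p\times p}$, $B_i\in\mathbb{R}^{p\times m}$, $i=1,\dots,n$, defining the MIMO system $y^{(n)}+A_1y^{(n-1)}+\dots+A_ny=B_1u^{(n-1)}+\dots+B_nu$, $y(t)\in\mathbb{R}^p$, $u(t)\in\mathbb{R}^m$. Assumption 1': this input–output system is the input–output description of a reachable and observable state-space system $\dot{\bar x}=\bar A\bar x+\bar Bu$, $y=\bar C\bar x$ of dimension $h=pn$ with $\mathrm{rank}\,\mathrm{col}(\bar C,\bar C\bar A,\dots,\bar C\bar A^{n-1})=h$. Define $C_{\mathrm M}=[0_{p,p(n-1)}\;I_p]$, $A_{\mathrm M}\in\mathbb{R}^{pn\times pn}$ whose first $p(n-1)$ columns are $\begin{bmatrix}0_{p,p(n-1)}\\ I_{p(n-1)}\end{bmatrix}$ and whose last $p$ columns are $\mathrm{col}(-A_n,\dots,-A_1)$, and $B_{\mathrm M}=\mathrm{col}(B_n,\dots,B_1)$. For real $c_1,\dots,c_n$, $A_{\mathrm r}\in\mathbb{R}^{n\times n}$ has first $n-1$ rows $[0_{n-1,1}\;I_{n-1}]$ and last row $(-c_n,\dots,-c_1)$, $B_{\mathrm r}=(0,\dots,0,1)^\top\in\mathbb{R}^n$; $A_{\mathrm r,m}=A_{\mathrm r}\otimes I_m$, $B_{\mathrm r,m}=B_{\mathrm r}\otimes I_m$, $A_{\mathrm r,p}=A_{\mathrm r}\otimes I_p$, $B_{\mathrm r,p}=B_{\mathrm r}\otimes I_p$ ($\otimes$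 the Kronecker product). Define $A_{\mathrm M,\mathrm f}=\begin{bmatrix}A_{\mathrm r,m}&0_{mn,pn}\\ L_{B}&A_{\mathrm c}\end{bmatrix}$, where $L_B\in\mathbb{R}^{pn\times mn}$ has first $(n-1)p$ rows zero and last $p$ rows $[B_n\;\cdots\;B_1]$, and $A_{\mathrm c}\in\mathbb{R}^{pn\times pn}$ has first $(n-1)p$ rows $[0_{(n-1)p,p}\;I_{(n-1)p}]$ and last $p$ rows $[-A_n\;\cdots\;-A_1]$; $B_{\mathrm M,\mathrm f}=\mathrm{col}(B_{\mathrm r,m},0_{pn,m})$; $G_{\mathrm M,\mathrm f}=\mathrm{col}(0_{mn,pn},B_{\mathrm r,p}C_{\mathrm M})$. *)

(* Defs.v *)
From HB Require Import structures.
From mathcomp Require Import all_boot all_order all_algebra.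
From mathcomp Require Import all_classical all_reals all_analysis.
Set Implicit Arguments. Unset Strict Implicit. Unset Printing Implicit Defensive.
Import Order.TTheory GRing.Theory Num.Theory.
Import numFieldNormedType.Exports.
Local Open Scope classical_set_scope.
Local Open Scope ring_scope.

Section Defs.
Variable R : realType.

Definition mexp (k : nat) (A : 'M[R]_k) (t : R) : 'M[R]_k :=
  \matrix_(i, j) (limn (series (fun l : nat => t ^+ l / (l`!)%:R * (A ^+ l) i j))).

Definition reachable (N k : nat) (A : 'M[R]_N) (B : 'M[R]_(N, k)) : Prop :=
  \rank (@mxrow R N (fun _ => k) N (fun j : 'I_N => A ^+ j *m B)) = N.

(* Solution (Caratheodory sense, i.e. in integral form) on [0, +oo) of
   dz/dt = F(t), z(0) = z0 : for every t >= 0 each component of F is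
   Lebesgue integrable on [0,t] and z(t) = z0 + \int_0^t F(s) ds. *)
Definition ode_sol (k : nat) (F : R -> 'cV[R]_k) (z0 : 'cV[R]_k)
    (z : R -> 'cV[R]_k) : Prop :=
  forall t : R, 0 <= t -> forall i : 'I_k,
    (@lebesgue_measure R).-integrable `[0, t] (fun s => (F s i 0)%:E) /\
    z t i 0 = z0 i 0 + Rintegral (@lebesgue_measure R) `[0, t] (fun s => F s i 0).

Definition loc_integrable (k : nat) (u : R -> 'cV[R]_k) : Prop :=
  forall t : R, 0 <= t -> forall i : 'I_k,
    (@lebesgue_measure R).-integrable `[0, t] (fun s => (u s i 0)%:E).

(* Coefficients are indexed from 1: A i = A_i, B i = B_i, c i = c_i
   for 1 <= i <= n (index 0 is unused). *)
Variables (n m p : nat).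

Definition Ar (c : nat -> R) : 'M[R]_n :=
  \matrix_(i, j) (if (i < n.-1)%N then ((j : nat) == i.+1)%:R
                  else - c (n - j)%N).
Definition Br : 'cV[R]_n := \col_i ((i : nat) == n.-1)%:R.

Definition kronI (q : nat) (M : 'M[R]_n) : 'M[R]_(\sum_(i < n) q) :=
  @mxblock R n n (fun _ => q) (fun _ => q) (fun i j => (M i j)%:M).
Definition kronIc (q : nat) (v : 'cV[R]_n) : 'M[R]_(\sum_(i < n) q, q) :=
  @mxcol R n (fun _ => q) q (fun i => (v i 0)%:M).

Definition Arm c := kronI m (Ar c).
Definition Brm := kronIc m Br.
Definition Arp c := kronI p (Ar c).
Definition Brp := kronIc p Br.

Definition CM : 'M[R]_(p, \sum_(i < n) p) :=
  @mxrow R n (fun _ => p) p (fun j => if (j : nat) == n.-1 then 1%:M else 0).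

Definition AM (A : nat -> 'M[R]_p) : 'M[R]_(\sum_(i < n) p) :=
  @mxblock R n n (fun _ => p) (fun _ => p)
    (fun i j => if (j < n.-1)%N then ((i : nat) == j.+1)%:R%:M
                else - A (n - i)%N).

Definition BM (B : nat -> 'M[R]_(p, m)) : 'M[R]_(\sum_(i < n) p, m) :=
  @mxcol R n (fun _ => p) m (fun i => B (n - i)%N).

Definition LB (B : nat -> 'M[R]_(p, m)) : 'M[R]_(\sum_(i < n) p, \sum_(i < n) m) :=
  @mxblock R n n (fun _ => p) (fun _ => m)
    (fun i j => if (i : nat) == n.-1 then B (n - j)%N else 0).

Definition Ac (A : nat -> 'M[R]_p) : 'M[R]_(\sum_(i < n) p) :=
  @mxblock R n n (fun _ => p) (fun _ => p)
    (fun i j => if (i < n.-1)%N then ((j : nat) == i.+1)%:R%:M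
                else - A (n - j)%N).

Definition AMf c A B : 'M[R]_(\sum_(i < n) m + \sum_(i < n) p) :=
  block_mx (Arm c) 0 (LB B) (Ac A).
Definition BMf : 'M[R]_(\sum_(i < n) m + \sum_(i < n) p, m) :=
  col_mx Brm 0.
Definition GMf : 'M[R]_(\sum_(i < n) m + \sum_(i < n) p, \sum_(i < n) p) :=
  col_mx 0 (Brp *m CM).

Definition Acoef (A : nat -> 'M[R]_p) (i : nat) : 'M[R]_p :=
  if i == 0%N then 1%:M else A i.

(* (Ab, Bb, Cb) has the input-output description
   y^(n) + A_1 y^(n-1) + ... + A_n y = B_1 u^(n-1) + ... + B_n u :
   along every trajectory x' = Ab x + Bb u, y = Cb x one has
   y^(k) = Cb Ab^k x + sum_{j<k} Cb Ab^(k-1-j) Bb u^(j), so the identity holds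
   for all initial states and inputs iff
     sum_{i=0}^n A_i Cb Ab^(n-i) = 0    and
     B_k = sum_{i=0}^{k-1} A_i Cb Ab^(k-1-i) Bb  (1 <= k <= n). *)
Definition io_description (h : nat) (A : nat -> 'M[R]_p) (B : nat -> 'M[R]_(p, m))
    (Ab : 'M[R]_h) (Bb : 'M[R]_(h, m)) (Cb : 'M[R]_(p, h)) : Prop :=
  \sum_(i < n.+1) (Acoef A i *m Cb *m Ab ^+ (n - i)) = 0 /\
  forall k : nat, (1 <= k <= n)%N ->
    B k = \sum_(i < k) (Acoef A i *m Cb *m Ab ^+ (k.-1 - i) *m Bb).

Definition obs_rank (h : nat) (Ab : 'M[R]_h) (Cb : 'M[R]_(p, h)) : Prop :=
  \rank (@mxcol R n (fun _ => p) h (fun k : 'I_n => Cb *m Ab ^+ k)) = h.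

Definition assumption1' (A : nat -> 'M[R]_p) (B : nat -> 'M[R]_(p, m)) : Prop :=
  exists (Ab : 'M[R]_(p * n)) (Bb : 'M[R]_(p * n, m)) (Cb : 'M[R]_(p, p * n)),
    io_description A B Ab Bb Cb /\ reachable Ab Bb /\ obs_rank Ab Cb.

End Defs.

(* Main.v *)
(* Write [K_j = c_(n-j) I - A_(n-j)], so that [AM = Arp^T + col(K) CM] and
   [Ac = Arp + Brp row(K)], and similarly [BM = col(B_(n-j))] and
   [LB = Brp row(B_(n-j))].  For every family [K] there is a matrix [T_K] with
   [T_K Ar = Ar^T T_K], [T_K Br = col(K)] and [CM T_K = row(K)] (blockwise), because
   [Ar] is conjugate to [Ar^T] by a symmetric Hankel matrix.  Hence
   [z = x - T_K mu - T_B zeta] solves [z' = Arp^T z], [z(0) = x0], i.e.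
   [z(t) = exp(Arp^T t) x0], and substituting [y = CM x] in the equation of [mu]
   gives the equation of [chi].

   For reachability, let [w] be a row vector annihilating all [AMf^k BMf] and let
   [beta_k] be the last block of size [p] of [w AMf^k].  The companion structure turns
   the hypothesis into the recurrences [beta A(X) = 0] and [beta B(X) = 0], and
   minimality of the realization, whose dimension is [pn], makes [A(X)] and [B(X)]
   left coprime; so [beta = 0], whence [w = 0]. *)
Require Import Defs.
From HB Require Import structures.
From mathcomp Require Import all_boot all_order all_algebra.
From mathcomp Require Import all_classical all_reals all_analysis.
From mathcomp Require Import zify.
Import Order.TTheory GRing.Theory Num.Theory.
Import numFieldNormedType.Exports.
Local Open Scope classical_set_scope.
Local Open Scope ring_scope.

Set Implicit Arguments. Unset Strict Implicit. Unset Printing Implicit Defensive.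

(** * Companion matrices *)

Section Kronecker.
Variables (R : realType) (n p q : nat).
Implicit Types (M N : 'M[R]_n) (K : 'M[R]_(p, q)).

(** The right factor may be rectangular because the matrices [T_K] also map blocks of size [m] to
    blocks of size [p]. *)
Definition kron N K : 'M[R]_(\sum_(i < n) p, \sum_(i < n) q) :=
  @mxblock R n n (fun _ => p) (fun _ => q) (fun i j => N i j *: K).
Definition kronc (v : 'cV[R]_n) K : 'M[R]_(\sum_(i < n) p, q) :=
  @mxcol R n (fun _ => p) q (fun i => v i 0 *: K).
Definition kronr (v : 'rV[R]_n) K : 'M[R]_(p, \sum_(i < n) q) :=
  @mxrow R n (fun _ => q) p (fun j => v 0 j *: K).

Lemma kronI_mul M N K : kronI p M *m kron N K = kron (M *m N) K.
Proof.
rewrite /kronI /kron mul_mxblock; apply: eq_mxblock => i j.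
rewrite mxE scaler_suml; apply: eq_bigr => k _.
by rewrite mul_scalar_mx scalerA.
Qed.

Lemma kron_mulI M N K : kron N K *m kronI q M = kron (N *m M) K.
Proof.
rewrite /kronI /kron mul_mxblock; apply: eq_mxblock => i j.
rewrite mxE scaler_suml; apply: eq_bigr => k _.
by rewrite mul_mx_scalar scalerA mulrC.
Qed.

Lemma kron_mulIc N K (v : 'cV[R]_n) :
  kron N K *m kronIc q v = kronc (N *m v) K.
Proof.
rewrite /kronIc /kron mul_mxblock_mxrow; apply: eq_mxcol => i.
rewrite mxE scaler_suml; apply: eq_bigr => k _.
by rewrite mul_mx_scalar scalerA mulrC.
Qed.

(** [CM] is the Kronecker product of [Br^T] with the identity, so this is another case of the mixed
    product rule. *)
Lemma CM_mul_kron N K : CM R n p *m kron N K = kronr ((Br R n)^T *m N) K.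
Proof.
rewrite /CM /kron mul_mxrow_mxblock; apply: eq_mxrow => j.
rewrite mxE scaler_suml; apply: eq_bigr => k _.
rewrite !mxE; case: eqP => _; first by rewrite mul1mx mul1r.
by rewrite mul0mx mul0r scale0r.
Qed.

Lemma tr_kronI N : (kronI p N)^T = kronI p N^T.
Proof.
by rewrite /kronI tr_mxblock; apply: eq_mxblock => i j; rewrite tr_scalar_mx mxE.
Qed.

End Kronecker.

(** * Conjugating a companion matrix into its transpose *)

Section Intertwiner.
Variables (R : realType) (n' : nat) (c : nat -> R).
Notation n := n'.+1.
Notation Ar := (Ar n c).
Notation Br := (Br R n).

Definition monic_coef (i : nat) : R := if i == 0%N then 1 else c i.

(* Bezoutian of the monic polynomial with coefficients [c] and of the constant 1;
   it conjugates the companion matrix [Ar] into its transpose. *)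
Definition bezoutian : 'M[R]_n :=
  \matrix_(i, j) (if (i + j <= n')%N then monic_coef (n' - (i + j))%N else 0).

Lemma bezoutianT : bezoutian^T = bezoutian.
Proof. by apply/matrixP => i j; rewrite !mxE addnC. Qed.

Lemma bezoutian_Br : bezoutian *m Br = delta_mx 0 0.
Proof.
apply/matrixP => i k; rewrite !mxE (bigD1 ord_max)//= big1 ?addr0; last first.
  move=> j; rewrite -val_eqE/= => jn; rewrite !mxE/=.
  by rewrite (negbTE jn) mulr0.
rewrite !mxE eqxx mulr1 ord1 eqxx andbT -val_eqE/=.
have -> : (i + n' <= n')%N = (i == 0 :> nat) by lia.
by case: eqP => // ->; rewrite add0n subnn.
Qed.

(** Column [j] of [Ar] has a 1 in row [j - 1], absent when [j = 0], and [- c (n - j)] in its last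
    row. *)
Lemma mul_ArE q (M : 'M[R]_(q, n)) i (j : 'I_n) :
  (M *m Ar) i j = (if (0 < j)%N then M i (inord j.-1) else 0)
                  - M i ord_max * c (n - j)%N.
Proof.
rewrite mxE big_ord_recr/= !mxE/= ltnn mulrN; congr (_ - _).
case: ifPn => j0.
  have jn : (j.-1 < n')%N by rewrite prednK// -ltnS.
  rewrite (bigD1 (Ordinal jn))//= big1 ?addr0.
    rewrite !mxE/= jn prednK// eqxx mulr1; congr (M i _).
    by apply/val_inj; rewrite /= inordK// ltnW.
  move=> k; rewrite -val_eqE/= => kj; rewrite !mxE/= ltn_ord.
  case: eqP => [e|_]; last by rewrite mulr0.
  by rewrite e eqxx in kj.
rewrite big1// => k _; rewrite !mxE/= ltn_ord.
by case: eqP => [e|_]; [rewrite e in j0|rewrite mulr0].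
Qed.

(** As [bezoutian] is symmetric, the claim is that [bezoutian *m Ar] is symmetric. Away from row and
    column 0 its entries depend on [i + j] only; row and column 0 vanish outside the corner. *)
Lemma bezoutian_Ar : bezoutian *m Ar = Ar^T *m bezoutian.
Proof.
rewrite -[in RHS]bezoutianT -trmx_mul.
apply/matrixP => i j; rewrite [RHS]mxE !mul_ArE.
have e0 (k : 'I_n) : bezoutian k ord_max = ((k : nat) == 0%N)%:R.
  rewrite mxE; case: k => -[|k] kn /=; rewrite ?add0n ?leqnn ?subnn//.
  by case: ifP => //; lia.
have eS (k l : 'I_n) : (0 < l)%N -> bezoutian k (inord l.-1) =
    if (k + l <= n)%N then monic_coef (n - (k + l)) else 0.
  case: l => -[//|l] ln _; rewrite mxE /= (inordK (ltnW ln)).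
  by rewrite addnS ltnS subSS.
wlog: i j / (i <= j)%N.
  by move=> H; case: (leqP i j) => [|/ltnW] ij; [|symmetry]; exact: H.
rewrite !e0; case: (posnP i) => i0 ij; last first.
  have j0 : (0 < j)%N by lia.
  by rewrite j0 !eS// (gtn_eqF j0) [(j + i)%N]addnC !mul0r.
case: (posnP j) => [->|j0]; first by rewrite i0.
rewrite eS//= mul0r mul1r subr0.
rewrite i0 add0n (ltnW (ltn_ord j)) /monic_coef.
by rewrite gtn_eqF ?subrr ?subn_gt0.
Qed.

Lemma tr_Ar_exp_delta (j : 'I_n) :
  Ar^T ^+ j *m (delta_mx 0 0 : 'cV_n) = delta_mx j 0.
Proof.
case: j => j; elim: j => [|j IH] jn.
  by rewrite expr0 mul1mx; congr delta_mx; exact: val_inj.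
rewrite exprS -mulmxE -mulmxA (IH (ltnW jn)); apply/trmx_inj.
rewrite trmx_mul trmxK !trmx_delta; apply/rowP => i.
rewrite mxE (bigD1 (Ordinal (ltnW jn)))//= big1 ?addr0.
  rewrite !mxE !eqxx mul1r/= -ltnS jn; congr (_%:R).
by move=> k kj; rewrite !mxE (negbTE kj) andbF mul0r.
Qed.

(** This is [T_K]. Each [Ar^T ^+ j *m bezoutian] intertwines [Ar] with [Ar^T] and sends [Br] to the
    [j]-th basis vector, so the weights [K j] prescribe the image of [Brm]. *)
Definition intertwiner p q (K : nat -> 'M[R]_(p, q)) :
    'M[R]_(\sum_(i < n) p, \sum_(i < n) q) :=
  \sum_(j < n) kron (Ar^T ^+ j *m bezoutian) (K j).

Section Theory.
Variables (p q : nat) (K : nat -> 'M[R]_(p, q)).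

Lemma intertwiner_Ar :
  intertwiner K *m Arm n q c = (Arp n p c)^T *m intertwiner K.
Proof.
rewrite mulmx_suml mulmx_sumr; apply: eq_bigr => j _.
rewrite kron_mulI tr_kronI kronI_mul -mulmxA bezoutian_Ar !mulmxA.
by rewrite !mulmxE -exprS -exprSr.
Qed.

Lemma Ar_exp_bezoutian_Br (j : 'I_n) :
  Ar^T ^+ j *m bezoutian *m Br = delta_mx j 0.
Proof. by rewrite -mulmxA bezoutian_Br tr_Ar_exp_delta. Qed.

(** Moving the powers across [bezoutian] shows that [Ar^T ^+ j *m bezoutian] is symmetric; the claim
    is then the transpose of [Ar_exp_bezoutian_Br]. *)
Lemma Br_Ar_exp_bezoutian (j : 'I_n) :
  Br^T *m (Ar^T ^+ j *m bezoutian) = delta_mx 0 j.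
Proof.
have Ej k : Ar^T ^+ k *m bezoutian = bezoutian *m Ar ^+ k.
  elim: k => [|k IH]; first by rewrite !expr0 mulmx1 mul1mx.
  rewrite exprSr -mulmxE -mulmxA -bezoutian_Ar mulmxA IH -mulmxA.
  by rewrite mulmxE -exprSr.
apply: trmx_inj; rewrite trmx_mul trmxK Ej trmx_mul bezoutianT trmx_delta.
rewrite -tr_Ar_exp_delta -bezoutian_Br mulmxA; congr (_ *m _ *m _).
by elim: (val j) => [|k IH]; rewrite ?trmx1// exprS exprSr trmx_mul IH.
Qed.

Lemma intertwiner_Br :
  intertwiner K *m Brm R n q = @mxcol R n (fun _ => p) q (fun i => K i).
Proof.
rewrite mulmx_suml (eq_bigr (fun j => kronc (delta_mx j 0) (K j))); last first.
  by move=> j _; rewrite kron_mulIc Ar_exp_bezoutian_Br.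
rewrite /kronc -mxcol_sum; apply: eq_mxcol => i.
rewrite (bigD1 i)//= big1 ?addr0 => [|j ji]; first by rewrite mxE !eqxx scale1r.
by rewrite mxE eq_sym (negbTE ji) scale0r.
Qed.

Lemma CM_intertwiner :
  CM R n p *m intertwiner K = @mxrow R n (fun _ => q) p (fun j => K j).
Proof.
rewrite mulmx_sumr (eq_bigr (fun j => kronr (delta_mx 0 j) (K j))); last first.
  by move=> j _; rewrite CM_mul_kron Br_Ar_exp_bezoutian.
rewrite /kronr -mxrow_sum; apply: eq_mxrow => i.
rewrite (bigD1 i)//= big1 ?addr0 => [|j ji]; first by rewrite mxE !eqxx scale1r.
by rewrite mxE eqxx eq_sym (negbTE ji) scale0r.
Qed.

End Theory.

Section System.
Variables (m p : nat) (A : nat -> 'M[R]_p) (B : nat -> 'M[R]_(p, m)).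

(** The same family enters [AM] as a block column and [Ac] as a block row, so one [intertwiner]
    serves both. *)
Definition gap (j : nat) : 'M[R]_p := (c (n - j)%N)%:M - A (n - j)%N.

Lemma AM_companion :
  AM n A = (Arp n p c)^T + @mxcol R n (fun _ => p) p (fun i => gap i) *m CM R n p.
Proof.
rewrite tr_kronI /CM mul_mxcol_mxrow -mxblockD; apply: eq_mxblock => i j.
rewrite [_^T i j]mxE [Ar j i]mxE /=; case: ltnP => jn.
  by rewrite (ltn_eqF jn) mulmx0 addr0.
have -> : (j : nat) == n' by have := ltn_ord j; lia.
by rewrite mulmx1 /gap addrA -raddfD/= addNr raddf0 add0r.
Qed.

Lemma Ac_companion :
  Ac n A = Arp n p c + Brp R n p *m @mxrow R n (fun _ => p) p (fun i => gap i).
Proof.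
rewrite mul_mxcol_mxrow -mxblockD; apply: eq_mxblock => i j.
rewrite [Ar i j]mxE [Br i 0]mxE /=; case: ltnP => jn.
  by rewrite (ltn_eqF jn) raddf0 mul0mx addr0.
have -> : (i : nat) == n' by have := ltn_ord i; lia.
by rewrite mul1mx /gap addrA -raddfD/= addNr raddf0 add0r.
Qed.

Lemma LB_companion :
  LB n B = Brp R n p *m @mxrow R n (fun _ => m) p (fun i => B (n - i)%N).
Proof.
rewrite mul_mxcol_mxrow; apply: eq_mxblock => i j; rewrite [Br i 0]mxE.
by case: ifPn => _; rewrite ?mul1mx ?raddf0 ?mul0mx.
Qed.

End System.
End Intertwiner.

(** * Reachability *)

(** By Cayley-Hamilton, [M ^+ j] is the value at [M] of the remainder of ['X^j] by the
    characteristic polynomial, a combination of the first [N] powers. *)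
Lemma mul_exp_eq0 (R : fieldType) N k (M : 'M[R]_N) (B : 'M[R]_(N, k))
    (w : 'rV[R]_N) : (forall j : 'I_N, w *m M ^+ j *m B = 0) ->
  forall j, w *m M ^+ j *m B = 0.
Proof.
case: N M B w => [|N] M B w wMB j; first by rewrite [w]thinmx0 !mul0mx.
have [h [r [Xj sr]]] : exists h r : {poly R},
    'X^j = h * char_poly M + r /\ (size r <= N.+1)%N.
  exists ('X^j %/ char_poly M), ('X^j %% char_poly M); split.
    exact: divp_eq.
  by rewrite -ltnS -(size_char_poly M) ltn_modp monic_neq0// char_poly_monic.
have -> : M ^+ j = horner_mx M r.
  have <- : horner_mx M 'X^j = M ^+ j by rewrite rmorphXn/= horner_mx_X.
  by rewrite Xj rmorphD rmorphM/= Cayley_Hamilton mulr0 add0r.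
have -> : r = \sum_(i < N.+1) r`_i *: 'X^i.
  rewrite -poly_def; apply/polyP => i; rewrite coef_poly.
  by case: ltnP => // Ni; rewrite nth_default// (leq_trans sr).
rewrite linear_sum/= mulmx_sumr mulmx_suml big1// => i _.
by rewrite linearZ/= rmorphXn/= horner_mx_X -scalemxAr -scalemxAl wMB scaler0.
Qed.

(** Full row rank is triviality of the left kernel; letting [j] range over all naturals allows
    recurrences to run without a bound. *)
Lemma reachableP (R : realType) N k (M : 'M[R]_N) (B : 'M[R]_(N, k)) :
  reachable M B <->
  forall w : 'rV[R]_N, (forall j, w *m M ^+ j *m B = 0) -> w = 0.
Proof.
set C := @mxrow R N (fun _ => k) N (fun j : 'I_N => M ^+ j *m B).
split=> [rC w wMB|inj].
  have fC : row_free C by rewrite /row_free; apply/eqP.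
  apply: (row_free_inj fC); rewrite /= mul0mx mul_mxrow -[RHS]mxrow0.
  by apply: eq_mxrow => j; rewrite mulmxA wMB.
apply/eqP; apply: inj_row_free => w.
rewrite mul_mxrow -[RHS]mxrow0 => /eq_mxrowP wC.
by apply/inj/mul_exp_eq0 => j; rewrite -mulmxA; exact: wC.
Qed.

(** * Shift registers of block rows *)

Section ShiftRegister.
Variables (R : realType) (n' p q : nat).
Notation n := n'.+1.
Variables (D : nat -> 'M[R]_(p, q)) (beta : nat -> 'rV[R]_p).
Variable s : nat -> 'rV[R]_(\sum_(i < n) q).
Let blk (k j : nat) : 'rV[R]_q := @submxrow R n (fun _ => q) 1 (s k) (inord j).
Hypothesis sS : forall k (j : 'I_n), @submxrow R n (fun _ => q) 1 (s k.+1) j =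
  (if (0 < j)%N then blk k j.-1 else 0) + beta k *m D (n - j)%N.

Let blkS k j : (j < n)%N ->
  blk k.+1 j = (if (0 < j)%N then blk k j.-1 else 0) + beta k *m D (n - j)%N.
Proof. by move=> jn; rewrite {1}/blk sS inordK. Qed.

(** The content leaving at time [k + n] entered block 0 at time [k + 1]; on its way it collected
    [beta (k + i) *m D (n - i)] in block [i]. *)
Lemma shift_out k : @submxrow R n (fun _ => q) 1 (s (k + n)) ord_max =
  \sum_(i < n) beta (k + i)%N *m D (n - i)%N.
Proof.
suff H j : (j < n)%N ->
    blk (k + j.+1) j = \sum_(i < j.+1) beta (k + i)%N *m D (n - i)%N.
  by rewrite -H// /blk; congr submxrow; apply/val_inj; rewrite /= inordK.
elim: j => [|j IH] jn; first by rewrite addnS blkS// big_ord1 add0r.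
by rewrite addnS blkS// big_ord_recr/= IH// ltnW.
Qed.

(** Without injection, block [n' - d] reaches the last position unchanged after [d] steps, where it
    is zero. *)
Lemma shift_inj : (forall k, beta k = 0) ->
  (forall k, @submxrow R n (fun _ => q) 1 (s k) ord_max = 0) -> s 0%N = 0.
Proof.
move=> b0 smax.
have H d k : (d <= n')%N -> blk k (n' - d) = 0.
  elim: d k => [|d IH] k dn.
    rewrite subn0 /blk -(smax k); congr submxrow; apply/val_inj.
    by rewrite /= inordK.
  have := IH k.+1 (ltnW dn); rewrite blkS ?ltnS ?leq_subr//.
  by rewrite b0 mul0mx addr0 subn_gt0 dn -subnS.
apply/mxrowP => j; rewrite submxrow0.
have jn : (j <= n')%N by rewrite -ltnS.
by have := H (n' - j)%N 0%N (leq_subr _ _); rewrite subKn// /blk inord_val.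
Qed.

End ShiftRegister.

(* The left coprimeness of [A(X)] and [B(X)], as a statement on sequences:
   [beta] plays the role of a left annihilator, [q k = beta Q] with
   [A(X) Cb = Q(X) (X - Ab)] and [B(X) = Q(X) Bb]. *)
Lemma left_coprime (R : realType) (n' m p : nat) (A : nat -> 'M[R]_p)
    (B : nat -> 'M[R]_(p, m)) (beta : nat -> 'rV[R]_p) :
  let n := n'.+1 in
  assumption1' n A B ->
  (forall k, beta (k + n)%N + \sum_(i < n) beta (k + i)%N *m A (n - i)%N = 0) ->
  (forall k, \sum_(i < n) beta (k + i)%N *m B (n - i)%N = 0) ->
  forall k, beta k = 0.
Proof.
move=> n [Ab [Bb [Cb [[io1 io2] [/reachableP rAB obs]]]]] bA bB.
(* The [Q l] are the coefficients of the quotient [Q(X)]: [QS] is Horner's scheme for dividing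
   [A(X) Cb] by [X - Ab], and [io1] says that the remainder [Q n] vanishes. *)
pose Q l := \sum_(i < l.+1) (Acoef A i *m Cb *m Ab ^+ (l - i)).
have Q0 : Q 0%N = Cb by rewrite /Q big_ord1 /Acoef/= mul1mx mulmx1.
have QS l : Q l.+1 = Q l *m Ab + A l.+1 *m Cb.
  rewrite /Q big_ord_recr/= subnn mulmx1 mulmx_suml; congr (_ + _).
  apply: eq_bigr => i _; rewrite -[RHS]mulmxA mulmxE -exprSr subSn//.
  by rewrite -ltnS.
have Qn : Q n = 0 by [].
have QB l : (l < n)%N -> B l.+1 = Q l *m Bb.
  by move=> ln; rewrite io2// /Q mulmx_suml.
pose q k := \sum_(i < n) beta (k + i)%N *m Q (n' - i)%N.
have qB k : q k *m Bb = 0.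
  rewrite -[RHS](bB k) /q mulmx_suml; apply: eq_bigr => i _.
  by rewrite -mulmxA -QB ?ltnS ?leq_subr// -subSn// -ltnS.
(* The recurrence [bA] replaces the term [beta (k + n) *m Cb], which turns every [Q (n - i)] into
   [Q (n' - i) *m Ab]. *)
have qS k : q k.+1 = q k *m Ab.
  have -> : q k *m Ab = \sum_(i < n.+1) beta (k + i)%N *m Q (n - i)%N.
    rewrite big_ord_recr/= subnn Q0.
    rewrite -[beta (k + n)%N](addrK (\sum_(i < n) beta (k + i)%N *m A (n - i)%N)).
    rewrite bA sub0r mulNmx /q !mulmx_suml -sumrB; apply: eq_bigr => i _.
    have jn : (i <= n')%N by rewrite -ltnS.
    by rewrite subSn// QS mulmxDr -!mulmxA addrK.
  rewrite big_ord_recl/= subn0 Qn mulmx0 add0r; apply: eq_bigr => i _.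
  by rewrite /bump/= add1n addSnnS subSS.
have qE k j : q (k + j)%N = q k *m Ab ^+ j.
  elim: j => [|j IH]; first by rewrite addn0 expr0 mulmx1.
  by rewrite addnS qS IH -mulmxA mulmxE -exprSr.
have q0 k : q k = 0 by apply: rAB => j; rewrite -qE qB.
pose O := @mxcol R n (fun _ => p) (p * n) (fun k : 'I_n => Cb *m Ab ^+ k).
(* Here the dimension [p * n] matters: the observability matrix is square, so its full column rank
   is also full row rank. *)
have fO : row_free O.
  by rewrite /row_free; apply/eqP; rewrite obs sum_nat_const card_ord mulnC.
pose Ql l := @mxrow R n (fun _ => p) p
  (fun s : 'I_n => if (s <= l)%N then Acoef A (l - s) else 0).
have QE l : (l < n)%N -> Q l = Ql l *m O.
  move=> ln.
  transitivity (\sum_(s < l.+1) Acoef A (l - s) *m Cb *m Ab ^+ s).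
    rewrite /Q (reindex_inj rev_ord_inj)/=; apply: eq_bigr => s _.
    by rewrite subSS subKn// -ltnS.
  rewrite (big_ord_widen n (fun s => Acoef A (l - s) *m Cb *m Ab ^+ s))//.
  rewrite big_mkcond mul_mxrow_mxcol; apply: eq_bigr => s _; rewrite ltnS.
  by case: ifP => _; rewrite ?mulmxA ?mul0mx.
move=> k.
have : \sum_(i < n) beta (k + i)%N *m Ql (n' - i)%N = 0.
  apply: (row_free_inj fO); rewrite /= mul0mx -[RHS](q0 k) mulmx_suml.
  by apply: eq_bigr => i _; rewrite -mulmxA -QE// ltnS leq_subr.
(* Only [Ql n'] has a nonzero last block, the leading coefficient 1 of [A(X)]; the last block of the
   sum is therefore [beta k]. *)
move=> /(congr1 (fun M => @submxrow R n (fun _ => p) 1 M ord_max)).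
have sub l (v : 'rV_p) : @submxrow R n (fun _ => p) 1 (v *m Ql l) ord_max =
    v *m (if (n' <= l)%N then Acoef A (l - n') else 0).
  by rewrite -mul_submxrow /Ql mxrowK.
rewrite submxrow0 submxrow_sum (eq_bigr _ (fun i _ => sub _ _)).
rewrite big_ord_recl/= big1 ?addr0 => [|i _].
  by rewrite subn0 leqnn subnn addn0 mulmx1.
rewrite /bump add1n leqNgt ltn_subrL ltn0Sn/= (leq_ltn_trans _ (ltn_ord i))//.
by rewrite mulmx0.
Qed.

(** * Linear differential equations *)

Section Primitive.
Variable R : realType.
Notation leb := (@lebesgue_measure R).
Implicit Types (f g w v : R -> R) (a b : R).

(** One component of [ode_sol]; integrability is carried along, so that linear combinations create
    no side conditions. *)
Definition primitive f b w := forall t, 0 <= t ->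
  leb.-integrable `[0, t] (EFin \o f) /\
  w t = b + Rintegral leb `[0, t] f.

Arguments primitive : clear implicits.

Lemma primitiveD f g a b w v :
  primitive f a w -> primitive g b v -> primitive (f \+ g) (a + b) (w \+ v).
Proof.
move=> fw gv t t0; have [if_ ew] := fw t t0; have [ig ev] := gv t t0; split.
  by rewrite (_ : _ \o _ = (EFin \o f) \+ (EFin \o g))%E//; exact: integrableD.
by rewrite RintegralD//= ew ev addrACA.
Qed.

Lemma primitiveZ k f a w :
  primitive f a w -> primitive (fun s => k * f s) (k * a) (fun t => k * w t).
Proof.
move=> fw t t0; have [if_ ew] := fw t t0; split.
  exact: (integrableZl _ k if_).
by rewrite RintegralZl// ew mulrDr.
Qed.

Lemma primitive_cst a : primitive (cst 0) a (cst a).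
Proof.
move=> t t0; split; first exact: integrable0.
by rewrite Rintegral_cst// mul0r addr0.
Qed.

Lemma primitive_sum I (r : seq I) (f w : I -> R -> R) (b : I -> R) :
  (forall i, primitive (f i) (b i) (w i)) ->
  primitive (fun s => \sum_(i <- r) f i s) (\sum_(i <- r) b i)
            (fun t => \sum_(i <- r) w i t).
Proof.
move=> fw; elim: r => [|i r IH].
  rewrite (_ : (fun s => _) = cst 0); last by apply/funext => s; rewrite big_nil.
  rewrite (_ : (fun t => \sum_(i <- [::]) w i t) = cst 0); last first.
    by apply/funext => s; rewrite big_nil.
  by rewrite big_nil; exact: primitive_cst.
have := primitiveD (fw i) IH; rewrite big_cons.
by congr primitive; apply/funext => s; rewrite big_cons.
Qed.

Lemma primitive_eq f g b w : (forall t, 0 <= t -> f t = g t) ->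
  primitive f b w -> primitive g b w.
Proof.
move=> fg fw t t0; have [if_ ->] := fw t t0.
have fg' : {in `[0, t]%classic, f =1 g}.
  by move=> s; rewrite inE/= in_itv/= => /andP[s0 _]; exact: fg.
split; last by congr (_ + _); exact: eq_Rintegral.
by apply: eq_integrable if_ => // s ss /=; rewrite fg'.
Qed.

Lemma primitive_exp_coeff l : primitive (@exp_coeff R ^~ l) 0 (@exp_coeff R ^~ l.+1).
Proof.
have cf k : continuous (@exp_coeff R ^~ k : R -> R).
  by move=> x; apply: cvgM; [exact: exprn_continuous|exact: cvg_cst].
have df (x : R) : is_derive x 1 (@exp_coeff R ^~ l.+1 : R -> R) (exp_coeff x l).
  rewrite /exp_coeff/=.
  rewrite (_ : (fun x => _) = (l.+1)`!%:R^-1 *: (@idfun R) ^+ l.+1); last first.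
    by apply/funext => y; rewrite !fctE /= mulrC.
  apply: is_derive_eq.
  rewrite /= !/GRing.scale/= mulr1 factS natrM invfM mulrACA mulVf ?pnatr_eq0//.
  by rewrite mul1r mulrC.
move=> t t0; split.
  apply: continuous_compact_integrable; first exact: segment_compact.
  exact: continuous_subspaceT.
(* The fundamental theorem is applied on a nondegenerate interval, hence the separate case
   [t = 0]. *)
rewrite add0r; have [<-|tn0] := eqVneq 0 t.
  by rewrite set_itv1 Rintegral_set1 /exp_coeff/= expr0n mul0r.
have {tn0}t0 : 0 < t by rewrite lt_neqAle tn0.
rewrite /Rintegral (@continuous_FTC2 _ _ (@exp_coeff R ^~ l.+1))//.
- by rewrite /= /exp_coeff/= expr0n mul0r subr0.
- exact: continuous_subspaceT.
- split.
  + by move=> x _; case: (df x).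
  + by apply: cvg_at_right_filter; exact: cf.
  + by apply: cvg_at_left_filter; exact: cf.
- by move=> x _; rewrite derive1E; case: (df x).
Qed.

Lemma le_primitive f g w v b : primitive f b w -> primitive g 0 v ->
  forall t, 0 <= t -> (forall s, 0 <= s <= t -> `|f s| <= g s) ->
  `|w t| <= `|b| + v t.
Proof.
move=> fw gv t t0 fg; have [if_ ->] := fw t t0; have [ig ->] := gv t t0.
rewrite add0r (le_trans (ler_normD _ _))// lerD2l.
rewrite (le_trans (le_normr_Rintegral _ _))// le_Rintegral//.
exact: integrable_norm.
Qed.

(** The integral of [|f|] over all of [[0, T]] dominates. The bound is given as a value, so that
    bounds of several components can be summed. *)
Lemma primitive_bounded f b w T : primitive f b w -> 0 <= T ->
  {M : R | 0 <= M & forall t, 0 <= t <= T -> `|w t| <= M}.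
Proof.
move=> fw T0; exists (`|b| + Rintegral leb `[0, T] (fun s => `|f s|)).
  by rewrite addr_ge0// Rintegral_ge0.
move=> t /andP[t0 tT]; have [iT _] := fw T T0; have [it ->] := fw t t0.
rewrite (le_trans (ler_normD _ _))// lerD2l.
rewrite (le_trans (le_normr_Rintegral _ _))//.
have iTn := integrable_norm iT.
have sub : `[0, t] `<=` `[0, T] by apply: subset_itvl; rewrite bnd_simp.
rewrite /Rintegral fine_le//.
- by apply: integrable_fin_num => //; exact: integrable_norm.
- exact: integrable_fin_num.
- apply: ge0_subset_integral => //.
  by case/integrableP: iTn.
Qed.

End Primitive.

Lemma cvg_bigsum (R : realType) (I : Type) (r : seq I) (f : I -> nat -> R)
    (l : I -> R) : (forall i, f i @ \oo --> l i) ->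
  (fun k => \sum_(i <- r) f i k) @ \oo --> \sum_(i <- r) l i.
Proof.
move=> fl; elim: r => [|i r IH].
  rewrite big_nil (_ : (fun k => _) = cst 0); first exact: cvg_cst.
  by apply/funext => k; rewrite big_nil.
rewrite big_cons (_ : (fun k => _) = f i \+ (fun k => \sum_(j <- r) f j k)).
  exact: cvgD.
by apply/funext => k; rewrite big_cons.
Qed.

(** * Linear systems and the matrix exponential *)

Section LinearODE.
Variable R : realType.

Lemma ode_solP k (F : R -> 'cV[R]_k) z0 z :
  ode_sol F z0 z <->
  forall i, primitive (fun s => F s i 0) (z0 i 0) (fun t => z t i 0).
Proof. by split=> [H i t t0|H t t0 i]; [exact: H|exact: (H i t)]. Qed.

Lemma ode_sol_eq k (F G : R -> 'cV[R]_k) z0 z :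
  (forall t, 0 <= t -> F t = G t) -> ode_sol F z0 z -> ode_sol G z0 z.
Proof.
move=> FG /ode_solP Fz; apply/ode_solP => i.
by apply: primitive_eq (Fz i) => t t0; rewrite FG.
Qed.

Lemma ode_solD k (F G : R -> 'cV[R]_k) z0 w0 z w :
  ode_sol F z0 z -> ode_sol G w0 w ->
  ode_sol (fun t => F t + G t) (z0 + w0) (fun t => z t + w t).
Proof.
move=> /ode_solP Fz /ode_solP Gw; apply/ode_solP => i.
rewrite mxE; have := primitiveD (Fz i) (Gw i).
by congr primitive; apply/funext => s; rewrite mxE.
Qed.

Lemma ode_sol_mulmx k l (M : 'M[R]_(l, k)) (F : R -> 'cV[R]_k) z0 z :
  ode_sol F z0 z ->
  ode_sol (fun t => M *m F t) (M *m z0) (fun t => M *m z t).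
Proof.
move=> /ode_solP Fz; apply/ode_solP => i.
have := primitive_sum (index_enum 'I_k) (fun j => primitiveZ (M i j) (Fz j)).
by rewrite [(M *m z0) i 0]mxE; congr primitive; apply/funext => s; rewrite mxE.
Qed.

Lemma ode_solB k (F G : R -> 'cV[R]_k) z0 w0 z w :
  ode_sol F z0 z -> ode_sol G w0 w ->
  ode_sol (fun t => F t - G t) (z0 - w0) (fun t => z t - w t).
Proof.
move=> Fz /(@ode_sol_mulmx _ _ (-1)%:M)/(ode_solD Fz).
have e (v : 'cV[R]_k) : (-1)%:M *m v = - v by rewrite mul_scalar_mx scaleN1r.
by rewrite e; congr ode_sol; apply/funext => s; rewrite e.
Qed.

Lemma ode_sol_col_mx k l (F : R -> 'cV[R]_k) (G : R -> 'cV[R]_l) z0 w0 z w :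
  ode_sol F z0 z -> ode_sol G w0 w ->
  ode_sol (fun t => col_mx (F t) (G t)) (col_mx z0 w0)
          (fun t => col_mx (z t) (w t)).
Proof.
move=> /ode_solP Fz /ode_solP Gw; apply/ode_solP => i.
by rewrite -(fintype.splitK i); case: (fintype.split i) => j /=;
  [rewrite col_mxEu; have := Fz j|rewrite col_mxEd; have := Gw j];
  congr primitive; apply/funext => s; rewrite ?col_mxEu ?col_mxEd.
Qed.

Variables (k : nat) (M : 'M[R]_k).

Let a : R := \sum_i \sum_j `|M i j|.

Let a_ge0 : 0 <= a. Proof. by do 2 (apply: sumr_ge0 => ? _). Qed.

Let le_mulmx (v : 'cV[R]_k) b : (forall i, `|v i 0| <= b) ->
  forall i, `|(M *m v) i 0| <= a * b.
Proof.
move=> vb i; rewrite mxE (le_trans (ler_norm_sum _ _ _))//.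
have b0 : 0 <= b by exact: le_trans (vb i).
apply: (@le_trans _ _ ((\sum_j `|M i j|) * b)).
  by rewrite mulr_suml; apply: ler_sum => j _; rewrite normrM ler_wpM2l.
rewrite ler_wpM2r// [leRHS](bigD1 i)//= lerDl sumr_ge0// => j _.
exact: sumr_ge0.
Qed.

Let le_expmx l i j : `|(M ^+ l) i j| <= a ^+ l.
Proof.
have -> : (M ^+ l) i j = col j (M ^+ l) i 0 by rewrite mxE.
elim: l i => [|l IH] i.
  by rewrite !expr0 !mxE; case: eqP => _; rewrite ?normr1 ?normr0 ?ler01.
rewrite !exprS colE -mulmxE -mulmxA -colE; exact: le_mulmx.
Qed.

(** Comparison with the exponential series at [|t| * a]; it guarantees that the [limn] in [mexp] is
    a genuine limit. *)
Lemma is_cvg_mexp t i j :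
  cvgn (series (fun l : nat => t ^+ l / (l`!)%:R * (M ^+ l) i j)).
Proof.
apply: normed_cvg; apply: series_le_cvg (is_cvg_series_exp_coeff (`|t| * a)).
- by move=> l; exact: normr_ge0.
- by move=> l; apply: exp_coeff_ge0; rewrite mulr_ge0.
move=> l; rewrite /exp_coeff/= !normrM normrX normfV normr_nat exprMn.
by rewrite mulrAC ler_wpM2r ?invr_ge0// ler_wpM2l ?exprn_ge0.
Qed.

Let taylor (z0 : 'cV[R]_k) L t := \sum_(l < L) (exp_coeff t l) *: (M ^+ l *m z0).

(** The Taylor sums are the Picard iterates started from 0. *)
Let ode_sol_taylor z0 L :
  ode_sol (fun t => M *m taylor z0 L t) z0 (taylor z0 L.+1).
Proof.
elim: L => [|L IH].
  apply/ode_solP => i; have := primitive_cst (z0 i 0).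
  congr primitive; apply/funext => s; rewrite /taylor.
    by rewrite big_ord0 mulmx0 mxE.
  by rewrite big_ord1 /exp_coeff/= expr0 divr1 scale1r mul1mx.
have H : ode_sol (fun t => exp_coeff t L *: (M ^+ L.+1 *m z0)) 0
           (fun t => exp_coeff t L.+1 *: (M ^+ L.+1 *m z0)).
  apply/ode_solP => i.
  have := primitiveZ ((M ^+ L.+1 *m z0) i 0) (primitive_exp_coeff L).
  rewrite mulr0 [X in _ -> primitive _ X _]mxE.
  by congr primitive; apply/funext => s; rewrite [RHS]mxE mulrC.
have := ode_solD IH H; rewrite addr0; congr ode_sol; apply/funext => s.
  rewrite /taylor [in RHS]big_ord_recr/= mulmxDr -scalemxAr mulmxA.
  by rewrite mulmxE -exprS.
by rewrite /taylor [in RHS]big_ord_recr.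
Qed.

(** Integrating the estimate [L] times bounds the distance from [z] to the [L]-th Picard iterate by
    [b (a t)^L / L!], which tends to 0, while the iterates converge to the exponential. *)
Lemma ode_sol_linear z0 z : ode_sol (fun t => M *m z t) z0 z ->
  forall t, 0 <= t -> z t = mexp M t *m z0.
Proof.
move=> Mz T T0.
have /ode_solP Mz' := Mz.
pose b := \sum_i s2val (primitive_bounded (Mz' i) T0).
have zb t : 0 <= t <= T -> forall i, `|z t i 0| <= b.
  move=> tT i; rewrite /b (bigD1 i)//= ler_wpDr//.
    by apply: sumr_ge0 => j _; case: primitive_bounded.
  by case: primitive_bounded => /= c _; exact.
have zL L t : 0 <= t <= T -> forall i,
    `|(z t - taylor z0 L t) i 0| <= b * a ^+ L * exp_coeff t L.
  elim: L t => [|L IH] t tT i.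
    by rewrite /taylor big_ord0 subr0 /exp_coeff/= !expr0 divr1 !mulr1 zb.
  have /ode_solP/(_ i) H1 := ode_solB Mz (ode_sol_taylor z0 L).
  have H2 := primitiveZ (b * a ^+ L.+1) (primitive_exp_coeff L).
  rewrite mulr0 in H2; have /andP[t0 tT'] := tT.
  rewrite (le_trans (le_primitive H1 H2 t0 _))//; last first.
    by rewrite subrr mxE normr0 add0r.
  move=> s /andP[s0 st]; rewrite -mulmxBr.
  rewrite exprS [b * _]mulrCA -(mulrA a).
  by apply: le_mulmx => j; apply: IH; rewrite s0 (le_trans st).
apply/colP => i; apply/eqP; rewrite -subr_eq0.
have cT : (fun L => taylor z0 L T i 0) @ \oo --> (mexp M T *m z0) i 0.
  rewrite mxE (_ : (fun L => _) = fun L => \sum_j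
    series (fun l : nat => T ^+ l / (l`!)%:R * (M ^+ l) i j) L * z0 j 0).
    apply: cvg_bigsum => j; apply: cvgM; last exact: cvg_cst.
    by rewrite mxE; exact: is_cvg_mexp.
  apply/funext => L; rewrite summxE /series/=.
  under [RHS]eq_bigr do rewrite big_mkord mulr_suml.
  rewrite exchange_big/=; apply: eq_bigr => l _.
  by rewrite !mxE mulr_sumr; apply: eq_bigr => j _; rewrite mulrA.
have c0 : (fun L => (z T - taylor z0 L T) i 0) @ \oo --> (0 : R).
  apply: norm_cvg0.
  apply: (@squeeze_cvgr _ _ _ _ (cst 0) (fun L => b * exp_coeff (a * T) L)).
  - apply: nearW => L; rewrite normr_ge0/= (le_trans (zL _ _ _ _))// ?lexx ?T0//.
    by rewrite /exp_coeff/= exprMn !mulrA.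
  - exact: cvg_cst.
  - rewrite -[0](mulr0 b); apply: cvgM; first exact: cvg_cst.
    exact: cvg_exp_coeff.
have : (fun L => (z T - taylor z0 L T) i 0) @ \oo --> z T i 0 - (mexp M T *m z0) i 0.
  rewrite (_ : (fun L => _) = (fun L => z T i 0 - taylor z0 L T i 0)).
    by apply: cvgB => //; exact: cvg_cst.
  by apply/funext => L; rewrite !mxE.
by move=> /(cvg_unique (@Rhausdorff R)) /(_ c0)/eqP.
Qed.

End LinearODE.

(** * The filtered system *)

Section RowBlocks.
Variables (R : realType) (n' q : nat) (c : nat -> R).
Notation n := n'.+1.
Implicit Types a : 'rV[R]_(\sum_(i < n) q).
Let blk a (j : 'I_n) : 'rV[R]_q := @submxrow R n (fun _ => q) 1 a j.

Lemma submxrow_mul_Arm a (j : 'I_n) :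
  blk (a *m Arm n q c) j = (if (0 < j)%N then blk a (inord j.-1) else 0)
                           - c (n - j)%N *: blk a ord_max.
Proof.
rewrite -[a in LHS](submxrowK (q_ := fun=> q)) /blk.
rewrite mul_mxrow_mxblock mxrowK; apply/rowP => s.
transitivity (((\row_i blk a i 0 s) *m Ar n c) 0 j).
  by rewrite summxE mxE; apply: eq_bigr => i _; rewrite mul_mx_scalar !mxE mulrC.
by rewrite mul_ArE !mxE; case: ifP => _; rewrite !mxE mulrC.
Qed.

Lemma mul_Brm a : a *m Brm R n q = blk a ord_max.
Proof.
rewrite -[a in LHS](submxrowK (q_ := fun=> q)) mul_mxrow_mxcol.
rewrite big_ord_recr/= big1 => [|i _]; last first.
  by rewrite !mxE/= ltn_eqF// raddf0 mulmx0.
by rewrite !mxE eqxx mulmx1 add0r.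
Qed.

End RowBlocks.

Lemma reachable_filters (R : realType) (n' m p : nat) (A : nat -> 'M[R]_p)
    (B : nat -> 'M[R]_(p, m)) (c : nat -> R) :
  assumption1' n'.+1 A B -> reachable (AMf n'.+1 c A B) (BMf R n'.+1 m p).
Proof.
set n := n'.+1 => asm; apply/reachableP => w wMB.
pose s k := w *m AMf n c A B ^+ k.
pose a k := lsubmx (s k); pose b k := rsubmx (s k).
pose lastm (v : 'rV[R]_(\sum_(i < n) m)) := @submxrow R n (fun _ => m) 1 v ord_max.
pose lastp (v : 'rV[R]_(\sum_(i < n) p)) := @submxrow R n (fun _ => p) 1 v ord_max.
have sS k : row_mx (a k.+1) (b k.+1) =
    row_mx (a k *m Arm n m c + b k *m LB n B) (b k *m Ac n A).
  rewrite hsubmxK /s exprSr -mulmxE mulmxA -[w *m _]hsubmxK mul_row_block.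
  by rewrite mulmx0 add0r.
(* [BMf] reads off the last block of the filter part of a row. *)
have amax k : lastm (a k) = 0.
  rewrite /lastm -mul_Brm -[RHS](wMB k) -[w *m _ in RHS]hsubmxK.
  by rewrite mul_row_col mulmx0 addr0.
(* By [amax] the feedback through [c] vanishes, leaving a pure shift register. *)
have aS k (j : 'I_n) : @submxrow R n (fun _ => m) 1 (a k.+1) j =
    (if (0 < j)%N then @submxrow R n (fun _ => m) 1 (a k) (inord j.-1) else 0)
    + lastp (b k) *m B (n - j)%N.
  have [-> _] := eq_row_mx (sS k); rewrite submxrowD submxrow_mul_Arm.
  rewrite [X in _ *: X]amax scaler0 subr0 LB_companion mulmxA mul_Brm.
  by rewrite -mul_submxrow mxrowK.
(* The coefficients [c] of [Arp] cancel against those in [gap], so only [- A] is injected. *)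
have bS k (j : 'I_n) : @submxrow R n (fun _ => p) 1 (b k.+1) j =
    (if (0 < j)%N then @submxrow R n (fun _ => p) 1 (b k) (inord j.-1) else 0)
    + lastp (b k) *m (- A (n - j)%N).
  have [_ ->] := eq_row_mx (sS k).
  rewrite (Ac_companion n' c) mulmxDr submxrowD submxrow_mul_Arm mulmxA mul_Brm.
  rewrite -mul_submxrow mxrowK /gap mulmxDr mul_mx_scalar addrA subrK.
  by rewrite mulmxN.
pose beta k := lastp (b k).
have aS' := @shift_out R n' p m B beta a aS.
have bS' := @shift_out R n' p p (fun i => - A i) beta b bS.
(* [bS'] is the recurrence for [A]; [aS'] combined with [amax] is the one for [B]. *)
have lb0 : forall k, lastp (b k) = 0.
  apply: (left_coprime asm) => k.
    rewrite [lastp (b _)]bS' -big_split big1//= => i _.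
    by rewrite mulmxN addNr.
  by rewrite -aS'; exact: amax.
have a0 : a 0%N = 0 by exact: (@shift_inj R n' p m B beta a aS lb0 amax).
have b0 : b 0%N = 0 by exact: (@shift_inj R n' p p (fun i => - A i) beta b bS lb0 lb0).
by rewrite -[w]mulmx1 -[w *m _]hsubmxK [lsubmx _]a0 [rsubmx _]b0 row_mx0.
Qed.

Lemma ode_sol_filters (R : realType) (n' m p : nat) (A : nat -> 'M[R]_p)
    (B : nat -> 'M[R]_(p, m)) (c : nat -> R) x0 u x zeta mu :
  let n := n'.+1 in
  ode_sol (fun t => AM n A *m x t + BM n B *m u t) x0 x ->
  ode_sol (fun t => Arm n m c *m zeta t + Brm R n m *m u t) 0 zeta ->
  ode_sol (fun t => Arp n p c *m mu t + Brp R n p *m (CM R n p *m x t)) 0 mu ->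
  ode_sol (fun t => AMf n c A B *m col_mx (zeta t) (mu t) + BMf R n m p *m u t
                    + GMf R n m p *m (mexp (Arp n p c)^T t *m x0))
          0 (fun t => col_mx (zeta t) (mu t)).
Proof.
move=> n xE zetaE muE.
pose Tm := intertwiner n' c (fun j => B (n - j)%N).
pose Tp := intertwiner n' c (gap n' c A).
have TmA : Tm *m Arm n m c = (Arp n p c)^T *m Tm by exact: intertwiner_Ar.
have TpA : Tp *m Arp n p c = (Arp n p c)^T *m Tp by exact: intertwiner_Ar.
have TmB : Tm *m Brm R n m = BM n B by exact: intertwiner_Br.
have AME : AM n A = (Arp n p c)^T + Tp *m Brp R n p *m CM R n p.
  by rewrite (AM_companion n' c) [Tp *m _]intertwiner_Br.
have LBE : LB n B = Brp R n p *m CM R n p *m Tm.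
  by rewrite LB_companion -mulmxA [CM _ _ _ *m _]CM_intertwiner.
have AcE : Ac n A = Arp n p c + Brp R n p *m CM R n p *m Tp.
  by rewrite (Ac_companion n' c) -mulmxA [CM _ _ _ *m _]CM_intertwiner.
(* From here on only the identities satisfied by [Tm] and [Tp] are kept, not their definitions. *)
move: Tm Tp TmA TpA TmB AME LBE AcE => Tm Tp TmA TpA TmB AME LBE AcE.
pose z t := x t - (Tp *m mu t + Tm *m zeta t).
have zE : ode_sol (fun t => (Arp n p c)^T *m z t) x0 z.
  have := ode_solB xE (ode_solD (ode_sol_mulmx Tp muE) (ode_sol_mulmx Tm zetaE)).
  rewrite !mulmx0 addr0 subr0; apply: ode_sol_eq => t _.
  rewrite /z mulmxBr AME -TmB mulmxDl !mulmxDr !mulmxA TmA TpA.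
  by rewrite -[X in X - _]addrA [X in _ - X]addrACA opprD addrACA subrr addr0.
rewrite -col_mx0.
apply: ode_sol_eq (ode_sol_col_mx zetaE muE) => t t0.
(* The exponential term is traded for [z]; expanding [CM z] produces exactly the corrections in
   [LBE] and [AcE] with opposite sign, leaving [CM x]. *)
rewrite -(ode_sol_linear zE)// /AMf mul_block_col mul0mx addr0 !mul_col_mx.
rewrite !mul0mx !add_col_mx !addr0; congr col_mx.
rewrite /z mulmxA mulmxBr LBE AcE mulmxDl !mulmxDr !mulmxA.
by rewrite [X in _ = X + _]addrC -[X in _ = X + _]addrA addrACA subrr addr0.
Qed.

Theorem theorem1 (R : realType) (n m p : nat)
    (A : nat -> 'M[R]_p) (B : nat -> 'M[R]_(p, m)) :
  (0 < n)%N -> (0 < m)%N -> (0 < p)%N ->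
  @assumption1' R n m p A B ->
  forall (c : nat -> R) (x0 : 'cV[R]_(\sum_(i < n) p)) (u : R -> 'cV[R]_m)
         (x : R -> 'cV[R]_(\sum_(i < n) p))
         (zeta : R -> 'cV[R]_(\sum_(i < n) m))
         (mu : R -> 'cV[R]_(\sum_(i < n) p)),
  loc_integrable u ->
  ode_sol (fun t => @AM R n p A *m x t + @BM R n m p B *m u t) x0 x ->
  ode_sol (fun t => @Arm R n m c *m zeta t + @Brm R n m *m u t) 0 zeta ->
  ode_sol (fun t => @Arp R n p c *m mu t + @Brp R n p *m (@CM R n p *m x t))
          0 mu ->
  ode_sol (fun t => @AMf R n m p c A B *m col_mx (zeta t) (mu t)
                    + @BMf R n m p *m u t
                    + @GMf R n m p *m (mexp (@Arp R n p c)^T t *m x0))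
          0 (fun t => col_mx (zeta t) (mu t))
  /\ reachable (@AMf R n m p c A B) (@BMf R n m p).
Proof.
case: n => [//|n'] _ _ _ asm c x0 u x zeta mu _ xE zetaE muE.
by split; [exact: ode_sol_filters xE zetaE muE|exact: reachable_filters].
Qed.
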